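(* Let $\{x^k\}$ be generated by the inexact random block coordinate descent algorithm described in the context, with $\operatorname{rank}(A)+1\le l\le N$. Given $\delta>0$, suppose that $0\le\epsilon_k\le\epsilon<1$ for all $k$ and $\sum_{k=0}^\infty\hat\epsilon_k\le\delta$. Let $x^*$ be an optimal solution of the linear program. Then there is a constant $\kappa$ depending only on the matrix $A$ and the vector $c$ such that: 1. $\|Ax^k-b\|\le\delta$ and $x^k\ge 0$ almost surely for any $k\ge 0$; 2. $c^Tx^k\ge c^Tx^*-\kappa\delta$ (almost surely) for any $k\ge 0$; 3. $\mathbb{E}[c^Tx^k-(c^Tx^*+\kappa\delta)]\le(1-(1-\epsilon)v)^k\,\mathbb{E}[c^Tx^0-(c^Tx^*+\kappa\delta)]$ for any $k\ge 0$, where $v\in(0,1]$ is the constant in the expected Gauss-Southwell-q rule (see context).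
   Context: Consider the linear program $\min_{x\in\mathbb{R}^N} c^Tx$ subject to $Ax=b$, $x\ge 0$, where $A\in\mathbb{R}^{M\times N}$, $b\in\mathbb{R}^M$, $c\in\mathbb{R}^N$, $M\le N$. It is assumed that the optimal value is finite and attained. Write $\mathcal{N}=\{1,\dots,N\}$; $\|\cdot\|$ is the Euclidean norm. For $x\in\mathbb{R}^N$ with $x\ge0$ (not necessarily satisfying $Ax=b$) and $\mathcal{I}\subseteq\mathcal{N}$, let $\mathcal{D}(x;\mathcal{I})$ and $q(x;\mathcal{I})$ denote respectively the set of optimal solutions and the optimal value of $$\min_{d\in\mathbb{R}^N}\{c^Td : x+d\ge 0,\ Ad=0,\ d_i=0\ \ \forall i\in\mathcal{N}\setminus\mathcal{I}\}.$$ Inexact random block coordinate descent: given nonnegative (deterministic) sequences $\{\epsilon_k\}_{k\ge0}$, $\{\hat\epsilon_k\}_{k\ge0}$, a batch size $l$, and a feasible $x^0$ (i.e. $Ax^0=b$, $x^0\ge0$), at each iteration $k=0,1,2,\dots$: (1) choose $\mathcal{I}_k$ uniformly at random (independently of the past) among the subsets of $\mathcal{N}$ with $|\mathcal{I}_k|=l$; (2) find $d^k$ such that, for any $d^k_*\in\mathcal{D}(x^k;\mathcal{I}_k)$, $$c^Td^k\le(1-\epsilon_k)c^Td^k_*,\quad x^k+d^k\ge0,\quad \|Ad^k\|\le\hat\epsilon_k,\quad d^k_i=0\ \ \forall i\notin\mathcal{I}_k;$$ (3) set $x^{k+1}=x^k+d^k$. Expected Gauss-Southwell-q rule: with $\mathcal{F}_k=\{x^0,\dots,x^k\}$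 the history of the algorithm, $v\in(0,1]$ is a constant such that $\mathbb{E}[q(x^k;\mathcal{I}_k)\mid\mathcal{F}_k]\le v\,q(x^k;\mathcal{N})$ for all $k\ge0$. When $\mathcal{I}_k$ is chosen uniformly at random (independently of the past) among the subsets of $\mathcal{N}$ of cardinality $l$, with $\operatorname{rank}(A)+1\le l\le N$, the rule holds with some $v\ge\frac{1}{\binom{N}{l}(N-l+1)}$. *)

(* Defs.v *)
From HB Require Import structures.
From mathcomp Require Import all_boot all_order all_algebra.
From mathcomp Require Import all_classical all_reals all_analysis.
From mathcomp Require Import measurable_realfun.

Set Implicit Arguments.
Unset Strict Implicit.
Unset Printing Implicit Defensive.

Import Order.TTheory GRing.Theory Num.Theory.
Import numFieldNormedType.Exports.

Local Open Scope classical_set_scope.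
Local Open Scope ring_scope.

Definition dot (R : realType) (n : nat) (u v : 'cV[R]_n) : R :=
  \sum_(i < n) u i 0 * v i 0.

(* The norm `|v| that MathComp-Analysis puts on matrices is the sup norm. *)
Definition norm2 (R : realType) (n : nat) (v : 'cV[R]_n) : R :=
  Num.sqrt (dot v v).

Definition nonneg (R : realType) (n : nat) (v : 'cV[R]_n) : Prop :=
  forall i, 0 <= v i 0.

Definition lp_feasible (R : realType) (M N : nat) (A : 'M[R]_(M, N))
    (b : 'cV[R]_M) (x : 'cV[R]_N) : Prop :=
  A *m x = b /\ nonneg x.

Definition lp_optimal (R : realType) (M N : nat) (A : 'M[R]_(M, N))
    (b : 'cV[R]_M) (c x : 'cV[R]_N) : Prop :=
  lp_feasible A b x /\ forall y, lp_feasible A b y -> dot c x <= dot c y.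

Definition sub_feasible (R : realType) (M N : nat) (A : 'M[R]_(M, N))
    (x : 'cV[R]_N) (J : {set 'I_N}) : set 'cV[R]_N :=
  [set d | [/\ nonneg (x + d), A *m d = 0
             & forall i, i \notin J -> d i 0 = 0]].

(* D(x; J) *)
Definition sub_optimal (R : realType) (M N : nat) (A : 'M[R]_(M, N))
    (c x : 'cV[R]_N) (J : {set 'I_N}) : set 'cV[R]_N :=
  [set d | sub_feasible A x J d /\
           forall d', sub_feasible A x J d' -> dot c d <= dot c d'].

(* q(x; J); extended-real, so that it is meaningful without knowing in advance
   that the subproblem is feasible and bounded. *)
Definition sub_value (R : realType) (M N : nat) (A : 'M[R]_(M, N))
    (c x : 'cV[R]_N) (J : {set 'I_N}) : \bar R :=
  ereal_inf [set (dot c d)%:E | d in sub_feasible A x J].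

Definition inexact_direction (R : realType) (M N : nat) (A : 'M[R]_(M, N))
    (c : 'cV[R]_N) (e he : R) (J : {set 'I_N}) (x d : 'cV[R]_N) : Prop :=
  [/\ forall ds, sub_optimal A c x J ds -> dot c d <= (1 - e) * dot c ds,
      nonneg (x + d),
      norm2 (A *m d) <= he
    & forall i, i \notin J -> d i 0 = 0].

(* F_k = sigma(x^0, ..., x^k), generated by the coordinates of the iterates. *)
Definition history (R : realType) (N : nat) (T : Type)
    (x : nat -> T -> 'cV[R]_N) (k : nat) : set (set T) :=
  <<s [set B | exists (j : nat) (i : 'I_N) (V : set R),
         [/\ (j <= k)%N, measurable V & B = (fun w => x j w i 0) @^-1` V]] >>.

(* Y is a version of the conditional expectation E[X | G], for a
   sub-sigma-algebra G. *)
Definition is_cond_exp (R : realType) (disp : measure_display)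
    (T : measurableType disp) (P : probability T R) (G : set (set T))
    (X Y : T -> \bar R) : Prop :=
  [/\ P.-integrable setT X,
      P.-integrable setT Y,
      forall V : set (\bar R), measurable V -> G (Y @^-1` V)
    & forall B, G B ->
        (\int[P]_(w in B) Y w = \int[P]_(w in B) X w)%E].

(* A run of the inexact random block coordinate descent method from the
   deterministic point x0, with batch size l and tolerances e, he.  The choice
   of the direction may use extra randomness; the requirements on it are only
   imposed almost surely. *)
Record inexact_rbcd (R : realType) (M N : nat) (A : 'M[R]_(M, N))
    (b : 'cV[R]_M) (c : 'cV[R]_N) (l : nat) (e he : nat -> R) (x0 : 'cV[R]_N)
    (disp : measure_display) (T : measurableType disp) (P : probability T R)
    (J : nat -> T -> {set 'I_N}) (d x : nat -> T -> 'cV[R]_N) : Prop :=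
  InexactRBCD {
    rbcd_start_feasible : lp_feasible A b x0;
    rbcd_start : forall w, x 0%N w = x0;
    rbcd_measurable_block : forall k S, measurable [set w | J k w = S];
    rbcd_measurable_dir : forall k i, measurable_fun setT (fun w => d k w i 0);
    rbcd_uniform : forall k S,
      P [set w | J k w = S] =
        (if #|S| == l then ('C(N, l)%:R)^-1 else 0)%:E;
    rbcd_independent : forall k S B, history x k B ->
      P ([set w | J k w = S] `&` B) = (P [set w | J k w = S] * P B)%E;
    rbcd_direction : forall k,
      {ae P, forall w, inexact_direction A c (e k) (he k) (J k w)
                         (x k w) (d k w)};
    rbcd_update : forall k w, x k.+1 w = x k w + d k w
  }.

(* E[q(x^k; J_k) | F_k] <= v q(x^k; {1..N}) almost surely, for all k. *)
Definition expected_gs_q (R : realType) (M N : nat) (A : 'M[R]_(M, N))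
    (c : 'cV[R]_N) (disp : measure_display) (T : measurableType disp)
    (P : probability T R) (J : nat -> T -> {set 'I_N})
    (x : nat -> T -> 'cV[R]_N) (v : R) : Prop :=
  forall k, exists2 Y : T -> \bar R,
    is_cond_exp P (history x k) (fun w => sub_value A c (x k w) (J k w)) Y &
    {ae P, forall w, (Y w <= v%:E * sub_value A c (x k w) [set: 'I_N]%SET)%E}.

(* Main.v *)
(** Everything rests on one reduction, which replaces LP duality.  If [dot c]
    is nonpositive on the vectors of [ker A] that are sign-compatible with [w],
    then [w] can be moved along [ker A], without creating new signs and without
    decreasing [dot c], until the columns of [A] indexed by its support are
    linearly independent; such a vector is recovered from its image under [A]
    by one of finitely many matrices, which depend on [A] alone.

    Applied to nonnegative vectors, the reduction shows that the subproblems
    attain their minimum.  Applied to the difference of a feasible point of the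
    program with right-hand side [b] and an optimal point of the program with
    right-hand side [b'], it shows that the optimal value is Lipschitz in the
    right-hand side, with a constant [kappa] depending on [A] and [c].  Since
    [A x^k - b] is the sum of the errors [A d^j], this gives the almost sure
    bounds, and it also gives
    [q(x^k; {1..N}) <= - (c^T x^k - c^T xstar - kappa delta)].  Combined with
    the expected Gauss-Southwell-q rule and
    [c^T d^k <= (1 - eps) q(x^k; J_k)], this contracts the expected gap by the
    factor [1 - (1 - eps) v] at each step. *)
Require Import Defs.
From HB Require Import structures.
From mathcomp Require Import all_boot all_order all_algebra.
From mathcomp Require Import all_classical all_reals all_analysis.
From mathcomp Require Import measurable_realfun.
From mathcomp Require Import ring lra.

Set Implicit Arguments.
Unset Strict Implicit.
Unset Printing Implicit Defensive.

Import Order.TTheory GRing.Theory Num.Theory.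
Import numFieldNormedType.Exports.

Local Open Scope classical_set_scope.
Local Open Scope ring_scope.

(** * Euclidean inner product and norm *)

Section dot_theory.
Variables (R : realType) (n : nat).
Implicit Types (a : R) (u v w : 'cV[R]_n).

Lemma dotDr u v w : dot u (v + w) = dot u v + dot u w.
Proof.
by rewrite /dot -big_split; apply: eq_bigr => i _; rewrite !mxE mulrDr.
Qed.

Lemma dotZr a u v : dot u (a *: v) = a * dot u v.
Proof.
by rewrite /dot mulr_sumr; apply: eq_bigr => i _; rewrite !mxE mulrCA.
Qed.

Lemma dotNr u v : dot u (- v) = - dot u v.
Proof. by rewrite -scaleN1r dotZr mulN1r. Qed.

Lemma dotBr u v w : dot u (v - w) = dot u v - dot u w.
Proof. by rewrite dotDr dotNr. Qed.

Lemma dotC u v : dot u v = dot v u.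
Proof. by apply: eq_bigr => i _; rewrite mulrC. Qed.

Lemma dotE u v : dot u v = (u^T *m v) 0 0.
Proof. by rewrite mxE; apply: eq_bigr => k _; rewrite mxE. Qed.

Lemma dotNl u v : dot (- u) v = - dot u v.
Proof. by rewrite dotC dotNr dotC. Qed.

Lemma dot_ge0 u : 0 <= dot u u.
Proof. by apply: sumr_ge0 => i _; rewrite -expr2 sqr_ge0. Qed.

Lemma norm2_ge0 u : 0 <= norm2 u.
Proof. exact: sqrtr_ge0. Qed.

Lemma sqr_norm2 u : norm2 u ^+ 2 = dot u u.
Proof. by rewrite sqr_sqrtr // dot_ge0. Qed.

Lemma norm2_0 : norm2 (0 : 'cV[R]_n) = 0.
Proof.
by rewrite /norm2 /dot big1 ?sqrtr0 // => i _; rewrite mxE mul0r.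
Qed.

Lemma norm2N u : norm2 (- u) = norm2 u.
Proof. by rewrite /norm2 dotNr dotC dotNr opprK. Qed.

(** Cauchy-Schwarz: the quadratic in [a] given by the squared norm of [u - a *: v] is nonnegative,
    in particular at its minimiser [dot u v / dot v v]. *)
Lemma dot_le_norm2 u v : dot u v <= norm2 u * norm2 v.
Proof.
have [uv0|uv0] := leP (dot u v) 0.
  by apply: (le_trans uv0); rewrite mulr_ge0 ?norm2_ge0.
rewrite -sqrtrM ?dot_ge0 // -[leLHS]ger0_norm ?(ltW uv0) // -sqrtr_sqr.
apply: ler_wsqrtr.
have q a : 0 <= dot v v * a ^+ 2 - 2 * dot u v * a + dot u u.
  have := dot_ge0 (u - a *: v).
  rewrite dotBr dotZr ![dot (u - _) _]dotC !dotBr !dotZr (dotC v u).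
  by move=> h; lra.
have [vv0|vv0] := eqVneq (dot v v) 0.
  (* With [dot v v = 0] the quadratic is affine in [a]; at this point it would equal -1. *)
  have := q ((dot u u + 1) / (2 * dot u v)).
  rewrite vv0 mul0r add0r mulrCA divff ?mulr1; last first.
    by rewrite mulf_neq0 ?gt_eqF.
  by lra.
have vv : 0 < dot v v by rewrite lt_neqAle eq_sym vv0 dot_ge0.
have := q (dot u v / dot v v).
rewrite -(pmulr_rge0 _ vv).
suff -> : dot v v * (dot v v * (dot u v / dot v v) ^+ 2 -
    2 * dot u v * (dot u v / dot v v) + dot u u) =
    dot u u * dot v v - dot u v ^+ 2 by rewrite subr_ge0.
by field.
Qed.

Lemma norm2D u v : norm2 (u + v) <= norm2 u + norm2 v.
Proof.
rewrite -(@ler_pXn2r _ 2) ?nnegrE ?addr_ge0 ?norm2_ge0 //.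
rewrite sqrrD !sqr_norm2 dotDr !(dotC (u + v)) !dotDr (dotC v u).
by have := dot_le_norm2 u v; lra.
Qed.

End dot_theory.

Lemma dot_mulmxr (R : realType) (m n : nat) (u : 'cV[R]_m) (B : 'M[R]_(m, n))
    (v : 'cV[R]_n) :
  dot u (B *m v) = dot (B^T *m u) v.
Proof. by rewrite !dotE trmx_mul trmxK mulmxA. Qed.

(** * Sign-compatible vectors and reduction to independent columns *)

Section linear_program.
Variables (R : realType) (M N : nat) (A : 'M[R]_(M, N)).
Implicit Types (c w x y z : 'cV[R]_N) (S : {set 'I_N}).

Definition supp w := [set i | w i 0 != 0]%SET.

Definition supp_in S w := forall i, i \notin S -> w i 0 = 0.

(** One product encodes both conditions: the support of [z] lies in that of [w], and the signs agree
    there. *)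
Definition conformal w z := forall i, z i 0 != 0 -> 0 < w i 0 * z i 0.

Definition independent_columns S :=
  forall z, supp_in S z -> A *m z = 0 -> z = 0.

Lemma supp_in_supp w : supp_in (supp w) w.
Proof. by move=> i; rewrite inE negbK => /eqP. Qed.

Lemma conformal_refl w : conformal w w.
Proof. by move=> i wi; rewrite -expr2 exprn_even_gt0. Qed.

Lemma conformal_trans w x y : conformal w x -> conformal x y -> conformal w y.
Proof.
move=> wx xy i yi; have xyi := xy i yi.
have xi : x i 0 != 0 by apply: contraTneq xyi => ->; rewrite mul0r ltxx.
have wxi := wx i xi.
rewrite -(@pmulr_lgt0 _ (x i 0 ^+ 2) (w i 0 * y i 0)) ?exprn_even_gt0 //.
have -> : w i 0 * y i 0 * x i 0 ^+ 2 = (w i 0 * x i 0) * (x i 0 * y i 0).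
  by ring.
by rewrite mulr_gt0.
Qed.

Lemma conformal_supp_in w z : conformal w z -> supp_in (supp w) z.
Proof.
move=> wz i; rewrite inE negbK => /eqP wi0; apply/eqP; apply/negPn/negP => zi.
by have := wz i zi; rewrite wi0 mul0r ltxx.
Qed.

Lemma conformal_nonneg w z : nonneg w -> conformal w z -> nonneg z.
Proof.
move=> w0 wz i; have [->//|zi] := eqVneq (z i 0) 0.
by rewrite ltW // -(@pmulr_rgt0 _ (w i 0) (z i 0)) ?wz // lt_neqAle w0 andbT;
  apply: contraTneq (wz i zi) => <-; rewrite mul0r ltxx.
Qed.

(* The ratio test of the simplex method: the step [t] is the first one at
   which a coordinate of [w + t *: z] vanishes. *)
Lemma conformal_step w z i0 : supp_in (supp w) z -> w i0 0 * z i0 0 < 0 ->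
  exists t, [/\ 0 < t, conformal w (w + t *: z) &
                (supp (w + t *: z) \proper supp w)%SET].
Proof.
move=> zw wz0.
pose P := fun i => w i 0 * z i 0 < 0.
pose r := fun i => - w i 0 / z i 0.
case: (@arg_minP _ _ _ i0 P r wz0) => j Pj rj.
have zn0 i : P i -> z i 0 != 0.
  by rewrite /P; apply: contraTneq => ->; rewrite mulr0 ltxx.
have wE i : P i -> w i 0 = - (r i * z i 0).
  by move=> /zn0 zi; rewrite /r; field.
have r0 i : P i -> 0 < r i.
  move=> Pi; rewrite -(@pmulr_lgt0 _ (z i 0 ^+ 2) (r i)); last first.
    by rewrite exprn_even_gt0 ?zn0.
  by have := Pi; rewrite /P (wE i Pi) mulNr oppr_lt0 -mulrA.
have wj : w j 0 != 0 by apply: contraTneq Pj => wj0; rewrite /P wj0 mul0r ltxx.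
have rjE : w j 0 + r j * z j 0 = 0 by rewrite (wE j Pj) addNr.
exists (r j); split; first exact: r0.
  move=> i; rewrite !mxE => wzi; rewrite lt_neqAle eq_sym; apply/andP; split.
    rewrite mulf_neq0 //; apply: contra_neq wzi => wi0.
    by rewrite wi0 (zw i) ?inE ?wi0 ?eqxx // mulr0 addr0.
  rewrite mulrDr; have [Pi|nPi] := boolP (P i); last first.
    rewrite addr_ge0 -?expr2 ?sqr_ge0 // mulrCA.
    by rewrite mulr_ge0 ?(ltW (r0 j Pj)) // leNgt.
  rewrite !wE // (_ : _ + _ = z i 0 ^+ 2 * (r i * (r i - r j))); last by ring.
  by rewrite mulr_ge0 ?sqr_ge0 // mulr_ge0 ?subr_ge0 ?rj // ltW // r0.
rewrite properE; apply/andP; split.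
  apply/fintype.subsetP => i; rewrite !inE !mxE; apply: contraNneq => wi0.
  by rewrite wi0 (zw i) ?inE ?wi0 ?eqxx // mulr0 addr0.
by apply/fintype.subsetPn; exists j; rewrite inE // !mxE negbK; apply/eqP.
Qed.

(** Strong induction on the size of the support: while the columns are dependent, a step along a
    kernel vector of nonnegative cost that opposes [w] in some coordinate shrinks the support. *)
Lemma conformal_reduction c w :
  (forall z, A *m z = 0 -> conformal w z -> dot c z <= 0) ->
  exists w', [/\ A *m w' = A *m w, conformal w w',
    independent_columns (supp w') & dot c w <= dot c w'].
Proof.
have [n] := ubnP #|supp w|; elim: n w => // n IHn w ltwn cw.
have [indep|] := pselect (independent_columns (supp w)).
  by exists w; split => //; exact: conformal_refl.
move=> /existsNP[z0 /not_implyP[z0w /not_implyP[Az0 z0n0]]].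
have [z [zw Az cz [i wzi]]] : exists z, [/\ supp_in (supp w) z, A *m z = 0,
    0 <= dot c z & exists i, w i 0 * z i 0 < 0].
  have [z [zw Az zn0 cz]] : exists z,
      [/\ supp_in (supp w) z, A *m z = 0, z <> 0 & 0 <= dot c z].
    have [cz0|cz0] := leP 0 (dot c z0); first by exists z0.
    exists (- z0); split => //.
    - by move=> i iw; rewrite mxE z0w // oppr0.
    - by rewrite mulmxN Az0 oppr0.
    - by move=> /eqP; rewrite oppr_eq0 => /eqP.
    - by rewrite dotNr oppr_ge0 ltW.
  have [wz|wz] := pselect (exists i, w i 0 * z i 0 < 0); first by exists z.
  (* If [z] never opposes [w], it is conformal to [w]; the hypothesis on [c] then forces cost zero,
     and [- z] serves instead. *)
  have wz0 i : 0 <= w i 0 * z i 0.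
    by rewrite leNgt; apply/negP => wzi; apply: wz; exists i.
  have wzc : conformal w z.
    move=> i zi; rewrite lt_neqAle wz0 andbT eq_sym mulf_neq0 //.
    by apply: contra_neq zi => wi; apply: zw; rewrite inE wi eqxx.
  have cz0 : dot c z = 0 by apply/eqP; rewrite eq_le cz cw.
  exists (- z); split.
  - by move=> i iw; rewrite mxE zw // oppr0.
  - by rewrite mulmxN Az oppr0.
  - by rewrite dotNr cz0 oppr0.
  have [zE|/existsNP[i zi]] := pselect (forall i, z i 0 = 0).
    by exfalso; apply: zn0; apply/matrixP => i j; rewrite ord1 zE mxE.
  by exists i; rewrite mxE mulrN oppr_lt0 wzc //; apply/eqP.
have [t [t0 wt ltS]] := conformal_step zw wzi.
have [|z' Az' wtz'|w' [Aw' ww' ind cw']] := IHn (w + t *: z).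
- exact: leq_trans (proper_card ltS) ltwn.
- exact: cw Az' (conformal_trans wt wtz').
exists w'; split => //.
- by rewrite Aw' mulmxDr -scalemxAr Az scaler0 addr0.
- exact: conformal_trans wt ww'.
- by apply: le_trans cw'; rewrite dotDr dotZr lerDl mulr_ge0 // ltW.
Qed.

(** * Recovery of a vector from its image, and Lipschitz dependence of the optimal value on the
    right-hand side *)

Definition coord_proj S : 'M[R]_N := diag_mx (\row_i (i \in S)%:R).

(** For independent columns this is a left inverse of [A] on the vectors supported in [S]. *)
Definition column_inverse S : 'M[R]_(N, M) :=
  coord_proj S *m pinvmx (A *m coord_proj S).

Lemma coord_proj_col S p (B : 'M[R]_(N, p)) i j :
  (coord_proj S *m B) i j = (i \in S)%:R * B i j.
Proof. by rewrite mul_diag_mx !mxE. Qed.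

Lemma coord_projE S w : supp_in S w -> coord_proj S *m w = w.
Proof.
move=> Sw; apply/matrixP => i j; rewrite coord_proj_col ord1.
by have [_|/Sw ->] := boolP (i \in S); rewrite ?mul1r ?mulr0.
Qed.

Lemma column_inverseK S w : independent_columns S -> supp_in S w ->
  column_inverse S *m (A *m w) = w.
Proof.
move=> ind Sw; rewrite -[in LHS](coord_projE Sw) !mulmxA.
rewrite -[column_inverse S *m _ *m _]mulmxA mulmxKpV ?coord_projE //.
(* It remains to place the row space of the projection in that of [A *m coord_proj S]. The columns
   of [Z] are supported in [S] and killed by [A], hence zero. *)
rewrite submxE; apply/eqP/matrixP => i j; set Z := _ *m _.
have -> : Z i j = col j Z i 0 by rewrite [RHS]mxE.
rewrite (ind (col j Z)) ?mxE //.
  by move=> k Sk; rewrite mxE coord_proj_col (negbTE Sk) mul0r.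
by rewrite colE mulmxA [A *m Z]mulmxA mulmx_coker mul0mx.
Qed.

(** A sum over all supports dominates the term of whichever support the reduction produces, and
    involves only [A] and [c]. *)
Definition lp_condition c : R :=
  \sum_(S : {set 'I_N}) norm2 ((column_inverse S)^T *m c).

Lemma lp_condition_ge0 c : 0 <= lp_condition c.
Proof. by apply: sumr_ge0 => S _; exact: norm2_ge0. Qed.

Lemma dot_le_condition c w : independent_columns (supp w) ->
  dot c w <= lp_condition c * norm2 (A *m w).
Proof.
move=> ind.
have -> : dot c w = dot ((column_inverse (supp w))^T *m c) (A *m w).
  by rewrite -dot_mulmxr column_inverseK //; exact: supp_in_supp.
apply: (le_trans (dot_le_norm2 _ _)); rewrite ler_wpM2r ?norm2_ge0 //.
rewrite /lp_condition (bigD1 (supp w)) //= lerDl.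
by apply: sumr_ge0 => S _; exact: norm2_ge0.
Qed.

(** The reduction replaces [x' - x] by a vector of no smaller cost, with independent support and the
    same image [b - A *m x], which bounds its cost. *)
Lemma lp_optimal_le (b : 'cV[R]_M) c x x' : nonneg x -> lp_optimal A b c x' ->
  dot c x' <= dot c x + lp_condition c * norm2 (A *m x - b).
Proof.
move=> x0 [[Ax' x'0] opt].
have [z Az wz|w [Aw _ ind cw]] := @conformal_reduction c (x' - x).
  (* Removing a small multiple of a kernel vector conformal to [x' - x] from
     the optimal point [x'] keeps it feasible. *)
  have [t t0 xt] : exists2 t, 0 < t & nonneg (x' - t *: z).
    (* The ratios are positive, since [z i 0 > 0] forces [x' i 0 > x i 0 >= 0]; the default 1 covers
       a [z] without positive coordinates. *)
    exists (\big[Num.min/1]_(i | 0 < z i 0) (x' i 0 / z i 0)).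
      apply: lt_bigmin => // i zi; rewrite divr_gt0 //.
      have := wz i; rewrite gt_eqF // => /(_ isT).
      rewrite !mxE pmulr_lgt0 // subr_gt0.
      exact: le_lt_trans (x0 i).
    move=> i; rewrite !mxE subr_ge0; have [zi|zi] := ltP 0 (z i 0).
      by rewrite -ler_pdivlMr // bigmin_le_cond.
    apply: le_trans (x'0 i); rewrite mulr_ge0_le0 //.
    by apply: le_bigmin => // j zj; rewrite divr_ge0 // ltW.
  have := opt (x' - t *: z) _.
  rewrite dotBr dotZr lerBrDl gerDr.
  rewrite pmulr_rle0 //; apply; split => //.
  by rewrite mulmxBr -scalemxAr Az scaler0 subr0.
have -> : dot c x' = dot c x + dot c (x' - x) by rewrite dotBr addrC subrK.
rewrite lerD2l (le_trans cw) // (le_trans (dot_le_condition _ ind)) //.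
by rewrite Aw mulmxBr Ax' -opprB norm2N.
Qed.

(** * Block subproblems: attainment and value *)

Lemma sub_optimal_exists c x S : nonneg x ->
  (forall z, nonneg z -> A *m z = 0 -> 0 <= dot c z) ->
  exists d, sub_optimal A c x S d.
Proof.
move=> x0 cpos; pose u := coord_proj S *m x.
pose F := [set y | [/\ nonneg y, A *m y = A *m u & supp_in S y]].
have uS : supp_in S u by move=> i iS; rewrite coord_proj_col (negbTE iS) mul0r.
have Fu : F u.
  by split => // i; rewrite coord_proj_col mulr_ge0 ?ler0n.
have feas d : sub_feasible A x S d <-> F (u + d).
  have ud i : i \in S -> (u + d) i 0 = (x + d) i 0.
    by move=> iS; rewrite mxE coord_proj_col iS mul1r mxE.
  split=> [[xd Ad dS]|[ud0 Aud udS]].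
    have udS : supp_in S (u + d).
      by move=> i iS; rewrite mxE uS // dS // addr0.
    split => //; last by rewrite mulmxDr Ad addr0.
    by move=> i; have [/ud ->|/udS ->] := boolP (i \in S).
  have dS : supp_in S d.
    by move=> i iS; have := udS i iS; rewrite mxE uS // add0r.
  split => //; last by move: Aud; rewrite mulmxDr -[RHS]addr0 => /addrI.
  move=> i; have [/ud <-//|iS] := boolP (i \in S).
  by rewrite mxE dS // addr0.
pose f T := column_inverse T *m (A *m u).
have basic y : F y -> exists T, F (f T) /\ dot c (f T) <= dot c y.
  move=> [y0 Ay yS].
  have [z Az yz|y' [Ay' yy' ind]] := @conformal_reduction (- c) y.
    by rewrite dotNl oppr_le0 cpos //; exact: conformal_nonneg yz.
  rewrite !dotNl lerN2 => cy'; exists (supp y').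
  have -> : f (supp y') = y'.
    by rewrite /f -Ay -Ay' column_inverseK //; exact: supp_in_supp.
  split => //; split; [exact: conformal_nonneg yy'|by rewrite Ay'|].
  move=> i iS; apply: (conformal_supp_in yy').
  by rewrite inE negbK yS.
have [T0 [FT0 _]] := basic u Fu.
case: (@arg_minP _ _ _ T0 (fun T => `[< F (f T) >]) (fun T => dot c (f T))).
  exact/asboolP.
move=> T /asboolP FT minT; exists (f T - u); split.
  by apply/feas; rewrite addrC subrK.
move=> d /feas /basic[T' [FT' le_T']].
rewrite dotBr lerBlDr addrC -dotDr; apply: le_trans le_T'.
by apply: minT; apply/asboolP.
Qed.

Lemma sub_valueE c x S d : sub_optimal A c x S d ->
  sub_value A c x S = (dot c d)%:E.
Proof.
move=> [Fd opt]; apply/eqP; rewrite eq_le; apply/andP; split.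
  by apply: ereal_inf_lbound; exists d.
by apply: le_ereal_inf_tmp => _ [d' Fd' <-]; rewrite lee_fin opt.
Qed.

Lemma sub_value_le0 c x S : nonneg x -> (sub_value A c x S <= 0)%E.
Proof.
move=> x0; apply: ereal_inf_lbound; exists 0.
  by split => [|| i _]; rewrite ?addr0 ?mulmx0 ?mxE.
by rewrite /dot big1 // => i _; rewrite mxE mulr0.
Qed.

(** The conclusion does not mention [b], so it also bounds the subproblems at iterates violating
    [A *m x = b]. *)
Lemma lp_optimal_recession (b : 'cV[R]_M) c x : lp_optimal A b c x ->
  forall z, nonneg z -> A *m z = 0 -> 0 <= dot c z.
Proof.
move=> [[Ax x0] opt] z z0 Az; have := opt (x + z).
rewrite dotDr lerDl; apply; split; first by rewrite mulmxDr Ax Az addr0.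
by move=> i; rewrite mxE addr_ge0.
Qed.

Lemma sub_optimal_lp_optimal c x d : sub_optimal A c x [set: 'I_N]%SET d ->
  lp_optimal A (A *m x) c (x + d).
Proof.
move=> [[xd Ad _] opt]; split; first by split; rewrite // mulmxDr Ad addr0.
move=> y [Ay y0]; rewrite dotDr -lerBrDl -dotBr; apply: opt.
split; first by rewrite addrC subrK.
  by rewrite mulmxBr Ay subrr.
by move=> i; rewrite finset.in_setT.
Qed.

(* From [x], the full block reaches the optimal value of the program with
   right-hand side [A *m x]. *)
Lemma sub_value_setT_le (b : 'cV[R]_M) c x xstar : nonneg x ->
  lp_optimal A b c xstar ->
  (sub_value A c x [set: 'I_N]%SET <=
   (dot c xstar + lp_condition c * norm2 (A *m x - b) - dot c x)%:E)%E.
Proof.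
move=> x0 opt.
have [d dopt] := sub_optimal_exists [set: 'I_N]%SET x0
  (lp_optimal_recession opt).
rewrite (sub_valueE dopt) lee_fin lerBrDl -dotDr.
have [[Ax xs0] _] := opt.
have := lp_optimal_le xs0 (sub_optimal_lp_optimal dopt).
by rewrite Ax -opprB norm2N.
Qed.

(** Attainment makes the inexactness test effective; the value is nonpositive, so replacing [e] by
    the larger [eps] only weakens the bound. *)
Lemma inexact_direction_le c e he eps S x d : e <= eps -> nonneg x ->
  (forall z, nonneg z -> A *m z = 0 -> 0 <= dot c z) ->
  inexact_direction A c e he S x d ->
  ((dot c d)%:E <= (1 - eps)%:E * sub_value A c x S)%E.
Proof.
move=> eeps x0 cpos [dle _ _ _].
have [ds dsopt] := sub_optimal_exists S x0 cpos.
have := sub_value_le0 c S x0; rewrite (sub_valueE dsopt) -EFinM !lee_fin => ds0.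
by rewrite (le_trans (dle ds dsopt)) // ler_wnM2r // lerB.
Qed.

(** * Deterministic estimates along one trajectory *)

Section trajectory.
Variables (b : 'cV[R]_M) (c : 'cV[R]_N) (e he : nat -> R).
Variables (J : nat -> {set 'I_N}) (d x : nat -> 'cV[R]_N).
Hypothesis x0_feasible : lp_feasible A b (x 0%N).
Hypothesis xS : forall k, x k.+1 = x k + d k.
Hypothesis d_inexact :
  forall k, inexact_direction A c (e k) (he k) (J k) (x k) (d k).

Lemma iterate_nonneg k : nonneg (x k).
Proof.
by case: k => [|k]; [case: x0_feasible|rewrite xS; case: (d_inexact k)].
Qed.

Lemma iterate_residual k : norm2 (A *m x k - b) <= \sum_(0 <= j < k) he j.
Proof.
elim: k => [|k IHk].
  by case: x0_feasible => -> _; rewrite subrr norm2_0 big_geq.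
rewrite big_nat_recr //= xS mulmxDr addrAC.
apply: (le_trans (norm2D _ _)); apply: lerD => //.
by case: (d_inexact k).
Qed.

(** The zero direction is always feasible, so no step raises the cost. This upper bound later gives
    integrability. *)
Lemma iterate_cost_le eps k : (forall j, e j <= eps) -> eps <= 1 ->
  (forall z, nonneg z -> A *m z = 0 -> 0 <= dot c z) ->
  dot c (x k) <= dot c (x 0%N).
Proof.
move=> eeps eps1 cpos; elim: k => // k; apply: le_trans.
rewrite xS dotDr gerDl -lee_fin.
apply: (le_trans (inexact_direction_le (eeps k) (iterate_nonneg k) cpos
  (d_inexact k))).
apply: mule_ge0_le0; first by rewrite lee_fin subr_ge0.
exact: sub_value_le0 (iterate_nonneg k).
Qed.

End trajectory.

End linear_program.

(** * Integrals under almost sure bounds *)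

Section ae_integral.
Context d (T : measurableType d) (R : realType).
Variable P : {measure set T -> \bar R}.
Local Open Scope ereal_scope.

Lemma ae_le_integral (f g : T -> \bar R) :
  P.-integrable setT f -> P.-integrable setT g ->
  {ae P, forall w, f w <= g w} -> \int[P]_w f w <= \int[P]_w g w.
Proof.
move=> /measurable_int mf /measurable_int mg fg.
rewrite integralE [leRHS]integralE leeB //; apply: ae_ge0_le_integral => //.
- exact: measurable_funepos.
- exact: measurable_funepos.
- by apply: filterS fg => w fgw _;
  rewrite !funeposE ge_max !le_max fgw lexx orbT.
- exact: measurable_funeneg.
- exact: measurable_funeneg.
- by apply: filterS fg => w fgw _;
  rewrite !funenegE ge_max !le_max leeN2 fgw lexx orbT.
Qed.

Lemma ae_bounded_integrable (f : T -> R) (B : R) :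
  P setT < +oo -> measurable_fun setT f ->
  {ae P, forall w, `|f w|%R <= B}%R -> P.-integrable setT (EFin \o f).
Proof.
move=> Pfin mf fB; apply/integrableP; split; first exact/measurable_EFinP.
apply: (@le_lt_trans _ _ (`|B|%:E * P setT)); last first.
  by rewrite lte_mul_pinfty.
apply: integral_le_bound => //; first exact/measurable_EFinP.
by apply: filterS fB => w fwB _; rewrite lee_fin (le_trans fwB) // ler_norm.
Qed.

End ae_integral.

(** * Almost sure bounds and integrability for the random iterates *)

Section inexact_rbcd_theory.
Variables (R : realType) (M N : nat) (A : 'M[R]_(M, N)) (b : 'cV[R]_M).
Variables (c xstar : 'cV[R]_N) (l : nat) (delta eps : R) (e he : nat -> R).
Variables (x0 : 'cV[R]_N) (disp : measure_display) (T : measurableType disp).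
Variables (P : probability T R) (J : nat -> T -> {set 'I_N}).
Variables (d x : nat -> T -> 'cV[R]_N).
Hypothesis xstar_optimal : lp_optimal A b c xstar.
Hypothesis eps_lt1 : eps < 1.
Hypothesis e_bound : forall k, 0 <= e k <= eps.
Hypothesis he_ge0 : forall k, 0 <= he k.
Hypothesis he_sum : (\sum_(0 <= k <oo) (he k)%:E <= delta%:E)%E.
Hypothesis run : inexact_rbcd A b c l e he x0 P J d x.

Let kappa := lp_condition A c.

Let cpos := lp_optimal_recession xstar_optimal.

Lemma rbcd_directions : {ae P, forall w, forall k,
  inexact_direction A c (e k) (he k) (J k w) (x k w) (d k w)}.
Proof. by apply: ae_foralln => k; exact: (rbcd_direction run k). Qed.

Let start w : lp_feasible A b (x 0%N w).
Proof. by rewrite (rbcd_start run); exact: rbcd_start_feasible run. Qed.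

Lemma rbcd_nonneg : {ae P, forall w, forall k, nonneg (x k w)}.
Proof.
apply: filterS rbcd_directions => w dw k.
exact: (iterate_nonneg (start w) (fun j => rbcd_update run j w) dw).
Qed.

Lemma rbcd_residual :
  {ae P, forall w, forall k, norm2 (A *m x k w - b) <= delta}.
Proof.
apply: filterS rbcd_directions => w dw k.
apply: (le_trans (iterate_residual (start w)
  (fun j => rbcd_update run j w) dw k)).
rewrite -lee_fin -sumEFin; apply: le_trans he_sum.
by apply: nneseries_lim_ge => j _ _; rewrite lee_fin.
Qed.

Lemma rbcd_cost_ge :
  {ae P, forall w, forall k, dot c xstar - kappa * delta <= dot c (x k w)}.
Proof.
apply: filterS2 rbcd_nonneg rbcd_residual => w xw rw k.
rewrite lerBlDr (le_trans (lp_optimal_le (xw k) xstar_optimal)) // lerD2l.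
by rewrite ler_wpM2l ?lp_condition_ge0.
Qed.

Lemma rbcd_cost_le : {ae P, forall w, forall k, dot c (x k w) <= dot c x0}.
Proof.
apply: filterS rbcd_directions => w dw k.
rewrite -(rbcd_start run w).
apply: (iterate_cost_le (start w) (fun j => rbcd_update run j w) dw
  (eps := eps)) => //; last exact: ltW.
by move=> j; have /andP[] := e_bound j.
Qed.

Lemma rbcd_measurable k i : measurable_fun setT (fun w => x k w i 0).
Proof.
elim: k => [|k IHk].
  by under eq_fun do rewrite (rbcd_start run); exact: measurable_cst.
under eq_fun do rewrite (rbcd_update run) mxE.
by apply: measurable_funD => //; exact: (rbcd_measurable_dir run).
Qed.

Lemma rbcd_cost_integrable m k :
  P.-integrable setT (EFin \o (fun w => dot c (x k w) - m)).
Proof.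
apply: (@ae_bounded_integrable _ _ _ _ _
  (`|dot c x0 - m| + `|dot c xstar - kappa * delta - m|)).
- by rewrite [ltLHS]probability_setT ltry.
- apply: measurable_funB => //; apply: measurable_sum => i.
  by apply: measurable_funM => //; exact: rbcd_measurable.
apply: filterS2 rbcd_cost_ge rbcd_cost_le => w /(_ k) lo /(_ k) hi.
have := ler_norm (dot c x0 - m).
have := ler_norm (- (dot c xstar - kappa * delta - m)).
have := normr_ge0 (dot c x0 - m).
have := normr_ge0 (dot c xstar - kappa * delta - m).
by rewrite normrN ler_norml => ? ? ? ?; apply/andP; split; lra.
Qed.

(** * Contraction of the expected gap *)

Let gap k w := dot c (x k w) - (dot c xstar + kappa * delta).

Lemma expected_gap_step (v : R) k : 0 < v <= 1 -> expected_gs_q A c P J x v ->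
  ('E_P[gap k.+1] <= (1 - (1 - eps) * v)%:E * 'E_P[gap k])%E.
Proof.
move=> /andP[v0 v1] /(_ k)[Y [intq intY _ EY] Yle].
have intg j : P.-integrable setT (EFin \o gap j) by exact: rbcd_cost_integrable.
have [g gE] : exists g, (\int[P]_w (gap k w)%:E = g%:E)%E.
  exists (fine (\int[P]_w (gap k w)%:E)%E); rewrite fineK //.
  exact: integrable_fin_num (intg k).
(* Total expectation: the whole space belongs to the history. *)
have EYq : (\int[P]_w Y w = \int[P]_w sub_value A c (x k w) (J k w))%E.
  apply: EY; rewrite -[[set: T]]setD0.
  by apply: sigma_algebraCD; exact: sigma_algebra0.
(* The Gauss-Southwell-q rule, followed by the bound of the full-block value by minus the gap. *)
have Y_le : (\int[P]_w Y w <= (- v)%:E * \int[P]_w (gap k w)%:E)%E.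
  rewrite -[leRHS](integralZl measurableT (intg k)).
  apply: ae_le_integral => //; first exact: integrableZl (intg k).
  apply: filterS3 Yle rbcd_nonneg rbcd_residual => w Yw xw rw.
  rewrite /= EFinN mulNe -muleN (le_trans Yw) // lee_pmul2l //.
  rewrite (le_trans (sub_value_setT_le (xw k) xstar_optimal)) // lee_fin.
  by rewrite /gap opprB lerD2r lerD2l ler_wpM2l ?lp_condition_ge0.
have step : (\int[P]_w (gap k.+1 w)%:E <= \int[P]_w ((gap k w)%:E +
    (1 - eps)%:E * sub_value A c (x k w) (J k w)))%E.
  apply: ae_le_integral => //; first exact: (intg k.+1).
    by apply: integrableD => //; [exact: (intg k)|exact: integrableZl].
  apply: filterS2 rbcd_nonneg rbcd_directions => w xw dw.
  rewrite /gap (rbcd_update run) dotDr addrAC EFinD leeD2l //.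
  apply: inexact_direction_le (xw k) cpos (dw k).
  by have /andP[] := e_bound k.
rewrite unlock (le_trans step) // integralD //; first last.
- exact: integrableZl.
- exact: (intg k).
rewrite integralZl // -EYq gE.
apply: (@le_trans _ _ (g%:E + (1 - eps)%:E * ((- v)%:E * g%:E))%E).
  rewrite gE in Y_le.
  by rewrite leeD2l // lee_wpmul2l ?lee_fin ?subr_ge0 ?(ltW eps_lt1).
by rewrite -!EFinM -EFinD lee_fin; lra.
Qed.

Lemma expected_gap (v : R) k : 0 < v <= 1 -> expected_gs_q A c P J x v ->
  ('E_P[gap k] <= ((1 - (1 - eps) * v) ^+ k)%:E * 'E_P[gap 0%N])%E.
Proof.
move=> v01 gs; elim: k => [|k IHk]; first by rewrite expr0 mul1e.
rewrite (le_trans (expected_gap_step k v01 gs)) // exprS EFinM -muleA.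
(* The gap may be negative, so the induction needs a nonnegative factor: [(1 - eps) * v <= 1], where
   [0 <= eps] comes from the bounds on [e 0]. *)
apply: lee_wpmul2l => //; rewrite lee_fin subr_ge0.
have /andP[v0 v1] := v01.
have /andP[e0 e1] := e_bound 0%N.
by rewrite mulr_ile1 ?subr_ge0 ?(ltW v0) ?(ltW eps_lt1) // gerBl (le_trans e0).
Qed.

End inexact_rbcd_theory.

Theorem theorem2 (R : realType) (M N : nat) (hMN : (M <= N)%N)
    (A : 'M[R]_(M, N)) (c : 'cV[R]_N) :
  exists kappa : R,
  forall (b : 'cV[R]_M) (xstar : 'cV[R]_N) (l : nat) (delta eps : R)
    (e he : nat -> R) (x0 : 'cV[R]_N)
    (disp : measure_display) (T : measurableType disp) (P : probability T R)
    (J : nat -> T -> {set 'I_N}) (d x : nat -> T -> 'cV[R]_N),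
    lp_optimal A b c xstar ->
    ((\rank A).+1 <= l <= N)%N ->
    0 < delta ->
    eps < 1 ->
    (forall k, 0 <= e k <= eps) ->
    (forall k, 0 <= he k) ->
    (\sum_(0 <= k <oo) (he k)%:E <= delta%:E)%E ->
    inexact_rbcd A b c l e he x0 P J d x ->
    [/\ forall k, {ae P, forall w,
          norm2 (A *m x k w - b) <= delta /\ nonneg (x k w)},
        forall k, {ae P, forall w,
          dot c xstar - kappa * delta <= dot c (x k w)}
      & forall v : R, 0 < v <= 1 -> expected_gs_q A c P J x v ->
        forall k,
          ('E_P[fun w => (dot c (x k w) - (dot c xstar + kappa * delta))%R]
           <= ((1 - (1 - eps) * v) ^+ k)%:E
              * 'E_P[fun w => (dot c (x 0%N w)
                               - (dot c xstar + kappa * delta))%R])%E].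
Proof.
exists (lp_condition A c) => b xstar l delta eps e he x0 disp T P J d x opt _ _.
move=> eps1 ebnd he0 hesum run; split.
- move=> k; apply: filterS2 (rbcd_nonneg run) (rbcd_residual he0 hesum run).
  by move=> w xw rw; split.
- move=> k; apply: filterS (rbcd_cost_ge opt he0 hesum run) => w; exact.
- move=> v v01 gs k.
  exact: (expected_gap opt eps1 ebnd he0 hesum run).
Qed.
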